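(* Let $\Bbbk$ be a field, let $n\ge 1$, let $P_n$ be the path on vertices $x_1,\dots,x_n$ with edges $\{x_i,x_{i+1}\}$ for $1\le i\le n-1$, and let $\mathcal C$ be a maximal (with respect to inclusion) independent set of $P_n$. Let $R=\Bbbk[x_1,\dots,x_n]$, $S=R[z]$, and let $G=P_n(\mathcal C)$ be the $\mathcal C$-suspension of $P_n$ with new vertex $z$. Then $$\mathfrak a(S/I(G))=\mathfrak a(R/I(P_n)),$$ except when $n=3k+1$ for some integer $k\ge 0$ and $\mathcal C=\{x_1,x_4,\dots,x_{3k+1}\}$; in this exceptional case $$\mathfrak a(S/I(G))=\mathfrak a(R/I(P_n))+1.$$
   Context: For a finite simple graph $H$ whose vertices are identified with the variables of a polynomial ring over $\Bbbk$, the edge ideal $I(H)$ is the ideal generated by the products $uv$ over all edges $\{u,v\}$ of $H$. An independent set is a set of pairwise non-adjacent vertices. For a graph $H$ and $\mathcal C\subseteq V(H)$, the $\mathcal C$-suspension $H(\mathcal C)$ is obtained from $H$ by adjoining a new vertex $z$ joined to every vertex of $\mathcal C$ and to no other vertices; thus $I(G)=I(P_n)+(zx_i:x_i\in\mathcal C)\subseteq S$. For a standard graded $\Bbbk$-algebra $A$ of Krull dimension $d$ with Hilbert series $h_A(t)/(1-t)^d$, $h_A$ a polynomial, the $\mathfrak a$-invariant is $\mathfrak a(A)=\deg h_A(t)-d$. *)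

(* Defs.v *)
From HB Require Import structures.
From mathcomp Require Import all_boot all_order all_algebra.
From mathcomp Require Import boolp.
From mathcomp Require Import mpoly.

Set Implicit Arguments.
Unset Strict Implicit.
Unset Printing Implicit Defensive.

Import GRing.Theory.
Local Open Scope ring_scope.
Local Open Scope quotient_scope.

Record sgraph (n : nat) := SGraph {
  adj :> rel 'I_n;
  adj_sym : ssrbool.symmetric adj;
  adj_irrefl : irreflexive adj
}.

Definition independent n (G : sgraph n) (A : {set 'I_n}) : bool :=
  [forall u in A, forall v in A, ~~ G u v].

(* The vertex x_i of the informal path x_1, ..., x_n is (i - 1 : 'I_n). *)
Definition path_adj n : rel 'I_n :=
  [rel i j : 'I_n | (i.+1 == j :> nat) || (j.+1 == i :> nat)].

Lemma path_adj_sym n : ssrbool.symmetric (@path_adj n).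
Proof. by move=> i j; rewrite /path_adj /= orbC. Qed.

Lemma path_adj_irrefl n : irreflexive (@path_adj n).
Proof. by move=> i; rewrite /path_adj /= orbb gtn_eqF. Qed.

Definition path_graph n : sgraph n :=
  SGraph (@path_adj_sym n) (@path_adj_irrefl n).

(* The new vertex z is ord_max : 'I_n.+1; an old vertex i : 'I_n is identified
   with lift ord_max i, which has the same value as i. *)
Definition suspension_adj n (G : sgraph n) (C : {set 'I_n}) : rel 'I_n.+1 :=
  fun u v =>
    match unlift ord_max u, unlift ord_max v with
    | Some i, Some j => G i j
    | Some i, None | None, Some i => i \in C
    | None, None => false
    end.

Lemma suspension_adj_sym n (G : sgraph n) (C : {set 'I_n}) :
  ssrbool.symmetric (suspension_adj G C).
Proof.
move=> u v; rewrite /suspension_adj.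
by case: unlift => [i|]; case: unlift => [j|] //; apply: adj_sym.
Qed.

Lemma suspension_adj_irrefl n (G : sgraph n) (C : {set 'I_n}) :
  irreflexive (suspension_adj G C).
Proof.
by move=> u; rewrite /suspension_adj; case: unlift => [i|] //; apply: adj_irrefl.
Qed.

Definition suspension n (G : sgraph n) (C : {set 'I_n}) : sgraph n.+1 :=
  SGraph (suspension_adj_sym G C) (suspension_adj_irrefl G C).

Section EdgeIdeal.
Variables (K : fieldType) (n : nat) (G : sgraph n).

Definition edge_ideal : pred {mpoly K[n]} := fun p =>
  `[< exists c : 'I_n -> 'I_n -> {mpoly K[n]},
        p = \sum_u \sum_(v | G u v) c u v * ('X_u * 'X_v) >].

Lemma edge_ideal_closed : idealr_closed edge_ideal.
Proof.
split.
- apply/asboolP; exists (fun _ _ => 0); symmetry.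
  by apply: big1 => u _; apply: big1 => v _; rewrite mul0r.
- apply/asboolP => -[c /(congr1 (meval (fun=> 0 : K)))].
  rewrite rmorph1 rmorph_sum /= big1 => [/eqP|u _]; first by rewrite oner_eq0.
  rewrite rmorph_sum big1 // => v _.
  by rewrite !rmorphM /= mevalXU mul0r mulr0.
move=> a p q /asboolP[c ->] /asboolP[d ->]; apply/asboolP.
exists (fun u v => a * c u v + d u v).
rewrite mulr_sumr -big_split; apply: eq_bigr => u _.
rewrite mulr_sumr -big_split; apply: eq_bigr => v _.
by rewrite /= mulrDl -!mulrA.
Qed.

HB.instance Definition _ :=
  isIdealr.Build {mpoly K[n]} edge_ideal edge_ideal_closed.

End EdgeIdeal.
Arguments edge_ideal K {n} G _.

Definition prime_chain (A : comNzRingType) (l : nat)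
    (P : 'I_l.+1 -> prime_idealr A) : Prop :=
  forall i j : 'I_l.+1, (i < j)%N ->
    {subset P i <= P j} /\ ~ {subset P j <= P i}.

Definition krull_dim (A : comNzRingType) (d : nat) : Prop :=
  (exists P : 'I_d.+1 -> prime_idealr A, prime_chain P) /\
  (forall l (P : 'I_l.+1 -> prime_idealr A), prime_chain P -> (l <= d)%N).

(* In the definitions below, the algebra K[x_0, ..., x_{n-1}]/I is given by a
   proper ideal I, meant to be homogeneous; its degree e component is the image
   of the space of homogeneous polynomials of degree e. *)

(* The degree e component has dimension m over K: the classes of b_0, ...,
   b_{m-1} form a basis of it. *)
Definition component_dim (K : fieldType) n (I : idealr {mpoly K[n]})
    (e m : nat) : Prop :=
  exists b : 'I_m -> {mpoly K[n]},
    (forall i, b i \is e.-homog) /\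
    (forall p : {mpoly K[n]}, p \is e.-homog ->
       exists! c : 'rV[K]_m, p = \sum_i c 0 i *: b i %[mod {ideal_quot I}]).

(* The Hilbert series \sum_e H(e) t^e equals h(t) / (1 - t)^d, stated as
   (\sum_e H(e) t^e) (1 - t)^d = h(t) coefficient by coefficient. *)
Definition hilbert_series_numerator (K : fieldType) n
    (I : idealr {mpoly K[n]}) (d : nat) (h : {poly int}) : Prop :=
  exists H : nat -> nat,
    (forall e, component_dim I e (H e)) /\
    (forall e, \sum_(j < e.+1) ((1 - 'X) ^+ d)`_j * (H (e - j)%N)%:Z = h`_e).

Definition a_invariant (K : fieldType) n (I : idealr {mpoly K[n]})
    (a : int) : Prop :=
  exists (d : nat) (h : {poly int}),
    [/\ krull_dim {ideal_quot I} d,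
        hilbert_series_numerator I d h
      & a = (size h).-1%:Z - d%:Z].

(* Main.v *)
Require Import Defs.
From HB Require Import structures.
From mathcomp Require Import all_boot all_order all_algebra.
From mathcomp Require Import boolp.
From mathcomp Require Import mpoly.
From mathcomp Require Import zify ring.

Set Implicit Arguments.
Unset Strict Implicit.
Unset Printing Implicit Defensive.

Import GRing.Theory.
Local Open Scope ring_scope.
Local Open Scope quotient_scope.

(* For an edge ideal the Hilbert series is a sum over independent sets, and the
   Krull dimension is the independence number d; hence the numerator is the
   homogenization (1 - X)^d F(X / (1 - X)) of the independence polynomial F, and
   the a-invariant is minus the multiplicity of -1 as a root of F.

   For the suspension, F_G = F_P + X W, where W is the independence polynomial
   of the path minus C.  The path minus a maximal independent set consists of
   isolated vertices and isolated edges, so W = (1 + X)^p (1 + 2X)^q.  The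
   recursion F_(n+2) = F_(n+1) + X F_n shows that -1 is a root of F_P exactly
   when n = 1 mod 3, and that it is then simple.  For such n one has p <> 1, so
   the term X W changes the multiplicity only when p = 0, and this is the
   exceptional case. *)

(** * Restriction of polynomials to a set of variables *)

Definition mnm_supp n (m : 'X_{1..n}) : {set 'I_n} := [set i | m i != 0%N].

Lemma independentS n (G : sgraph n) (A B : {set 'I_n}) :
  A \subset B -> independent G B -> independent G A.
Proof.
move=> sAB /forall_inP indB; apply/forall_inP => u uA.
apply/forall_inP => v vA.
by have /forall_inP := indB u (subsetP sAB u uA); apply; apply: (subsetP sAB).
Qed.

Section Restriction.
Variables (K : fieldType) (n : nat).
Implicit Types (p : {mpoly K[n]}) (A B : {set 'I_n}).

(** Reduction modulo the prime generated by the variables outside [A], realized as an endomorphism;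
    for independent [A] its kernel contains the edge ideal. *)
Definition restr A : {mpoly K[n]} -> {mpoly K[n]} :=
  comp_mpoly [tuple if i \in A then 'X_i else 0 | i < n].

HB.instance Definition _ A := GRing.LRMorphism.on (restr A).

Lemma restrXU A i : restr A 'X_i = if i \in A then 'X_i else 0.
Proof. by rewrite /restr comp_mpolyXU -tnth_nth tnth_mktuple. Qed.

Lemma restrX A m :
  restr A 'X_[m] = if mnm_supp m \subset A then 'X_[m] else 0.
Proof.
rewrite /restr comp_mpolyX; case: ifPn => [/subsetP sA|/subsetPn[i]].
  rewrite [RHS]mpolyXE_id; apply: eq_bigr => i _; rewrite tnth_mktuple.
  have [->|mi] := eqVneq (m i) 0%N; first by rewrite !expr0.
  by rewrite sA // inE.
rewrite inE => mi iA; rewrite (bigD1 i) //= tnth_mktuple (negPf iA).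
by rewrite expr0n (negPf mi) mul0r.
Qed.

Lemma mcoeff_restr A p m :
  (restr A p)@_m = if mnm_supp m \subset A then p@_m else 0.
Proof.
rewrite [in LHS](mpolyE p) (raddf_sum (restr A)) (raddf_sum (mcoeff m)) /=.
under eq_bigr => k _.
  rewrite linearZ /= restrX mcoeffZ (fun_if (mcoeff m)) mcoeffX mcoeff0.
  over.
case: ifPn => sA.
  rewrite [in RHS](mpolyE p) raddf_sum /=; apply: eq_bigr => k _.
  rewrite mcoeffZ mcoeffX; case: (eqVneq k m) => [->|_]; first by rewrite sA.
  by case: ifP; rewrite // mulr0.
apply: big1 => k _; case: (eqVneq k m) => [->|_].
  by rewrite (negPf sA) mulr0.
by case: ifP; rewrite // mulr0.
Qed.

Lemma restr_restr A B p : A \subset B -> restr A (restr B p) = restr A p.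
Proof.
move=> sAB; apply/mpolyP => m; rewrite !mcoeff_restr.
by case: ifP => // sA; rewrite (subset_trans sA sAB).
Qed.

End Restriction.

(** * Membership in the edge ideal *)

Section EdgeIdealMembership.
Variables (K : fieldType) (n : nat) (G : sgraph n).
Implicit Types p : {mpoly K[n]}.

Lemma edge_in_ideal u v : G u v -> 'X_u * 'X_v \in edge_ideal K G.
Proof.
move=> Guv; apply/asboolP.
exists (fun a b => if (a == u) && (b == v) then 1 else 0).
rewrite (bigD1 u) //= (bigD1 v) //= !eqxx mul1r big1 => [|b /andP[_ bv]].
  rewrite addr0 big1 ?addr0 // => a au; apply: big1 => b _.
  by rewrite (negPf au) mul0r.
by rewrite (negPf bv) mul0r.
Qed.

Lemma monomial_in_ideal m :
  ~~ independent G (mnm_supp m) -> 'X_[m] \in edge_ideal K G.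
Proof.
rewrite negb_forall_in => /exists_inP[u um].
rewrite negb_forall_in => /exists_inP[v vm]; rewrite negbK => Guv.
have uv : u != v by apply: contraTneq Guv => ->; rewrite adj_irrefl.
rewrite !inE in um vm.
have le : (U_(u) + U_(v) <= m)%MM.
  apply/mnm_lepP => i; rewrite mnmDE !mnm1E.
  have [<-|_] := eqVneq u i; first by rewrite eq_sym (negPf uv); lia.
  by have [<-|_] := eqVneq v i => //; lia.
by rewrite -(submK le) !mpolyXD; apply: idealMr; apply: edge_in_ideal.
Qed.

(** An edge product has a variable outside any independent [A], so it restricts to 0. Conversely, a
    monomial of [p] with independent support would survive restriction to that support, so every
    monomial of [p] lies in the ideal. *)
Lemma edge_idealP p :
  reflect (forall A, independent G A -> restr A p = 0) (p \in edge_ideal K G).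
Proof.
apply: (iffP idP) => [/asboolP[c ->] A /forall_inP indA|restr0].
  rewrite raddf_sum /= big1 // => u _; rewrite raddf_sum /= big1 // => v Guv.
  rewrite !rmorphM /= !restrXU; case: (boolP (u \in A)) => uA; last first.
    by rewrite mul0r mulr0.
  case: (boolP (v \in A)) => vA; last by rewrite !mulr0.
  by have /forall_inP/(_ v vA) := indA u uA; rewrite Guv.
rewrite (mpolyE p) big_seq; apply: rpred_sum => m mp.
rewrite -mul_mpolyC; apply/idealMr/monomial_in_ideal.
apply: contraTN mp => /restr0/(congr1 (mcoeff m)).
by rewrite mcoeff_restr subxx mcoeff0 mcoeff_msupp => ->; rewrite eqxx.
Qed.

Lemma edge_ideal_mcoeffP p :
  reflect (forall m, independent G (mnm_supp m) -> p@_m = 0)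
          (p \in edge_ideal K G).
Proof.
apply: (iffP (edge_idealP p)) => [p0 m /p0|p0 A indA].
  by move/(congr1 (mcoeff m)); rewrite mcoeff_restr subxx mcoeff0.
apply/mpolyP => m; rewrite mcoeff_restr mcoeff0; case: ifP => // sA.
by apply: p0; apply: independentS indA.
Qed.

End EdgeIdealMembership.

(** * Monomial bases of the graded components *)

Section Component.
Variables (K : fieldType) (n : nat) (G : sgraph n).

(* Independent exponent vectors of degree [e]; the bound [B] on the exponents
   only makes the type finite. *)
Definition indep_exponents (B e : nat) : {set {ffun 'I_n -> 'I_B.+1}} :=
  [set f : {ffun 'I_n -> 'I_B.+1} | (\sum_i f i == e :> nat)%N
     && independent G [set i | f i != ord0]].

(** In degree [e] no exponent exceeds [e]. This lets one bound serve all degrees up to [B] at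
    once. *)
Lemma card_indep_exponents B e :
  (e <= B)%N -> #|indep_exponents B e| = #|indep_exponents e e|.
Proof.
move=> leB; pose w (f : {ffun 'I_n -> 'I_e.+1}) : {ffun 'I_n -> 'I_B.+1} :=
  [ffun i => inord (f i)].
have wE f i : w f i = f i :> nat.
  by rewrite ffunE inordK // (leq_trans (ltn_ord _)).
have wI : injective w.
  move=> f g /ffunP fg; apply/ffunP => i; apply: val_inj => /=.
  by rewrite -!wE fg.
rewrite -(card_imset _ wI); apply: eq_card => g; apply/idP/imsetP => [|[f + ->]].
  rewrite inE => /andP[/eqP sg ig].
  have ge i : (g i < e.+1)%N.
    by rewrite ltnS -sg (bigD1 i) //= leq_addr.
  exists [ffun i => inord (g i) : 'I_e.+1]; last first.
    by apply/ffunP => i; apply: ord_inj; rewrite wE ffunE inordK.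
  rewrite inE; apply/andP; split.
    by apply/eqP; rewrite -[RHS]sg; apply: eq_bigr => i _; rewrite ffunE inordK.
  rewrite (_ : finset _ = [set i | g i != ord0]) //.
  by apply/setP => i; rewrite !inE ffunE -!val_eqE /= inordK.
rewrite !inE => /andP[/eqP sf indf]; apply/andP; split.
  by apply/eqP; rewrite -[RHS]sf; apply: eq_bigr => i _; apply: wE.
rewrite (_ : finset _ = [set i | f i != ord0]) //.
by apply/setP => i; rewrite !inE -!val_eqE /= wE.
Qed.

Definition mnm_of_ffun B (f : {ffun 'I_n -> 'I_B.+1}) : 'X_{1..n} :=
  [multinom (f i : nat) | i < n].

Lemma mnm_of_ffun_inj B : injective (@mnm_of_ffun B).
Proof.
move=> f g /mnmP fg; apply/ffunP => i; apply: val_inj.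
by have := fg i; rewrite !mnmE.
Qed.

(** The monomials of degree [e] with independent support form a basis, because membership in the
    ideal is the vanishing of their coefficients. *)
Lemma component_dim_edge_ideal e :
  component_dim (edge_ideal K G) e #|indep_exponents e e|.
Proof.
set S := indep_exponents e e.
pose b (i : 'I_#|S|) : 'X_{1..n} := mnm_of_ffun (enum_val i).
have bI : injective b by move=> i j /mnm_of_ffun_inj/enum_val_inj.
have supp_b i : independent G (mnm_supp (b i)).
  have := enum_valP i; rewrite inE => /andP[_].
  rewrite (_ : mnm_supp _ = [set j | enum_val i j != ord0]) //.
  by apply/setP => j; rewrite !inE mnmE.
have mdeg_b i : mdeg (b i) = e.
  have := enum_valP i; rewrite inE => /andP[/eqP + _].
  by rewrite mdegE => <-; apply: eq_bigr => j _; rewrite mnmE.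
have b_surj m : mdeg m = e -> independent G (mnm_supp m) -> exists i, b i = m.
  move=> dm im; have me i : (m i < e.+1)%N.
    by rewrite ltnS -dm mdegE (bigD1 i) //= leq_addr.
  pose f := [ffun i => inord (m i) : 'I_e.+1].
  have fE i : f i = m i :> nat by rewrite ffunE inordK.
  have fS : f \in S.
    rewrite inE; apply/andP; split.
      by apply/eqP; rewrite -[RHS]dm mdegE; apply: eq_bigr => i _; apply: fE.
    rewrite (_ : finset _ = mnm_supp m) //.
    by apply/setP => i; rewrite !inE -val_eqE /= fE.
  exists (enum_rank_in fS f); rewrite /b enum_rankK_in //.
  by apply/mnmP => i; rewrite mnmE fE.
exists (fun i => 'X_[b i]); split.
  by move=> i; rewrite dhomogX /= mdeg_b.
move=> p hp.
have modP (c : 'rV[K]_#|S|) :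
    (p = \sum_i c 0 i *: 'X_[b i]
       %[mod {ideal_quot (edge_ideal K G : idealr {mpoly K[n]})}])
    <-> (forall i, c 0 i = p@_(b i)).
  have cE j : (\sum_i c 0 i *: 'X_[b i])@_(b j) = c 0 j.
    rewrite raddf_sum /= (bigD1 j) //= mcoeffZ mcoeffX eqxx mulr1.
    rewrite big1 ?addr0 // => i ij; rewrite mcoeffZ mcoeffX.
    by rewrite (inj_eq bI) (negPf ij) mulr0.
  split=> [/eqP|cp].
    rewrite -Quotient.idealrBE => /edge_ideal_mcoeffP pc i; have := pc _ (supp_b i).
    by rewrite mcoeffB cE => /eqP; rewrite subr_eq0 => /eqP.
  apply/eqP; rewrite -Quotient.idealrBE.
  apply/edge_ideal_mcoeffP => m im; rewrite mcoeffB.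
  have [dm|dm] := eqVneq (mdeg m) e.
    by have [i <-] := b_surj _ dm im; rewrite cE cp subrr.
  rewrite (dhomog_nemf_coeff hp dm) raddf_sum /= big1 ?subr0 // => i _.
  rewrite mcoeffZ mcoeffX; case: eqP => [bm|]; last by rewrite mulr0.
  by rewrite -bm mdeg_b eqxx in dm.
exists (\row_i p@_(b i)); split; first by apply/modP => i; rewrite mxE.
by move=> c /modP cp; apply/rowP => i; rewrite mxE cp.
Qed.

End Component.

(** * Independence polynomial and Hilbert series *)

Definition indep_poly n (G : sgraph n) (D : {set 'I_n}) : {poly int} :=
  \sum_(A | independent G A && (A \subset D)) 'X^#|A|.

Section HilbertSeries.
Variables (K : fieldType) (n : nat) (G : sgraph n).

Definition indep_number : nat := \max_(A | independent G A) #|A|.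

Definition hilbert_numerator : {poly int} :=
  \sum_(A | independent G A) 'X^#|A| * (1 - 'X) ^+ (indep_number - #|A|).

(** Sorting exponent vectors by support factors the sum: each vertex of the support contributes
    [X + ... + X^B] independently. *)
Lemma indep_exponents_gen B :
  \sum_(f : {ffun 'I_n -> 'I_B.+1} | independent G [set i | f i != ord0])
      'X^(\sum_i f i)
  = \sum_(A | independent G A) (\sum_(k < B) ('X^(k.+1) : {poly int})) ^+ #|A|.
Proof.
pose s (f : {ffun 'I_n -> 'I_B.+1}) := [set i | f i != ord0].
rewrite (partition_big s (independent G)) //=; apply: eq_bigr => A indA.
transitivity (\prod_(i : 'I_n) \sum_(k < B.+1 | (k != ord0) == (i \in A))
                 ('X^k : {poly int})).
  rewrite bigA_distr_big_dep /=; apply: eq_big => [f|f _]; last by rewrite -prodrXr.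
  apply/andP/familyP => [[_ /eqP <-] i|fA]; first by rewrite inE; apply: eqxx.
  have sA : s f = A.
    by apply/setP => i; rewrite inE; move: (fA i); rewrite unfold_in => /eqP.
  by rewrite -/(s f) sA eqxx.
rewrite -[RHS]prodr_const [RHS]big_mkcond; apply: eq_bigr => i _.
rewrite big_mkcond big_ord_recl /=; case: (i \in A) => /=.
  by rewrite add0r; apply: eq_bigr.
by rewrite big1 // expr0 addr0.
Qed.

(* With [Q = X + ... + X^e] one has [(1 - X) Q = X (1 - X^e)], so up to degree
   [e] each factor [1 - X] cancels one factor [Q] into an [X]. *)
Lemma coef_geometric_cancel (a d e : nat) : (a <= d)%N ->
  (((1 - 'X) ^+ d * (\sum_(k < e) ('X^(k.+1) : {poly int})) ^+ a) : {poly int})`_e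
  = ('X^a * (1 - 'X) ^+ (d - a))`_e.
Proof.
move=> lead; rewrite -{1}(subnK lead) exprD -mulrA -exprMn.
have -> : (1 - 'X) * (\sum_(k < e) ('X^(k.+1) : {poly int})) = 'X * (1 - 'X^e) :> {poly int}.
  under eq_bigr do rewrite exprS.
  by rewrite -mulr_sumr mulrCA -[1 - 'X]opprB mulNr -subrX1 opprB.
rewrite exprMn mulrCA; case: a {lead} => [|a]; first by rewrite !expr0 mulr1.
(* Modulo [X^e] this power is 1; the positive power of [X] in front pushes the error term to degree
   at least [e + 1]. *)
have [r ->] : exists r : {poly int}, (1 - 'X^e) ^+ a.+1 = 1 + 'X^e * r.
  elim: a => [|a [r IH]]; first by exists (-1); rewrite expr1 mulrN1.
  by rewrite exprS IH; exists (r - 1 - 'X^e * r); ring.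
rewrite mulrDr mulr1 mulrDr coefD [X in _ + X](_ : _ = 0) ?addr0 //.
rewrite (_ : _ * _ = 'X^(e.+1) * ('X^a * ((1 - 'X) ^+ (d - a.+1) * r))).
  by rewrite coefXnM ltnS leqnn.
by rewrite !exprS; ring.
Qed.

Lemma hilbert_numerator_edge_ideal :
  hilbert_series_numerator (edge_ideal K G) indep_number hilbert_numerator.
Proof.
exists (fun e => #|indep_exponents G e e|); split=> [e|e].
  exact: component_dim_edge_ideal.
(* The coefficient in degree [e] only involves [H] up to [e], so exponents bounded by [e]
   suffice. *)
pose P : {poly int} :=
  \sum_(f : {ffun 'I_n -> 'I_e.+1} | independent G [set i | f i != ord0])
    'X^(\sum_i f i).
have PE j : (j <= e)%N -> P`_j = (#|indep_exponents G j j|)%:Z.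
  move=> je; rewrite -(card_indep_exponents G je) coef_sum -sum1_card.
  rewrite -natz natr_sum [RHS]big_mkcond [LHS]big_mkcond; apply: eq_bigr => f _.
  rewrite inE andbC coefXn eq_sym.
  by case: (independent _ _) => //=; case: eqP.
transitivity (((1 - 'X) ^+ indep_number * P)`_e).
  by rewrite coefM; apply: eq_bigr => j _; rewrite PE // leq_subr.
rewrite /P indep_exponents_gen /hilbert_numerator mulr_sumr !coef_sum.
by apply: eq_bigr => A indA; rewrite coef_geometric_cancel // leq_bigmax_cond.
Qed.

End HilbertSeries.

(** * Homogenization and its degree *)

(* The degree-[m] homogenization of [Q], with [1 - X] as homogenizing
   variable: formally [(1 - X)^m Q(X / (1 - X))]. *)
Definition homogenize (m : nat) (Q : {poly int}) : {poly int} :=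
  \sum_(k < m.+1) Q`_k *: ('X^k * (1 - 'X) ^+ (m - k)).

Lemma one_subX_exp m : (1 - 'X : {poly int}) ^+ m = (-1) ^+ m *: ('X - 1%:P) ^+ m.
Proof.
by rewrite -mul_polyC rmorphXn rmorphN rmorph1 -exprMn mulN1r opprB.
Qed.

Lemma size_1subX m : size ((1 - 'X : {poly int}) ^+ m) = m.+1.
Proof. by rewrite one_subX_exp size_scale ?signr_eq0 // size_exp_XsubC. Qed.

Lemma coef_1subX m : ((1 - 'X : {poly int}) ^+ m)`_m = (-1) ^+ m.
Proof.
have /monicP := monic_exp m (monicXsubC (1 : int)).
rewrite lead_coefE size_exp_XsubC /= one_subX_exp coefZ => ->.
by rewrite mulr1.
Qed.

(** The coefficient of [X^m] is [Q] at -1 up to sign, since [(1 - X)^(m - k)] has leading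
    coefficient [(-1)^(m - k)]. *)
Lemma size_homogenize m (Q : {poly int}) : (size Q <= m.+1)%N ->
  Q.[-1] != 0 -> size (homogenize m Q) = m.+1.
Proof.
move=> sQ Q1; apply/eqP; rewrite eqn_leq; apply/andP; split.
  apply: (leq_trans (size_sum _ _ _)); apply/bigmax_leqP => k _.
  apply: (leq_trans (size_scale_leq _ _)); apply: (leq_trans (size_polyMleq _ _)).
  by rewrite size_polyXn size_1subX addSn addnS /= subnKC // -ltnS.
rewrite ltnNge; apply: contra Q1 => /leq_sizeP/(_ m (leqnn m)).
rewrite coef_sum => hm.
suff -> : Q.[-1] = (-1) ^+ m * \sum_(k < m.+1) (Q`_k *: ('X^k * (1 - 'X) ^+ (m - k)))`_m.
  by rewrite hm mulr0.
rewrite (horner_coef_wide _ sQ) mulr_sumr; apply: eq_bigr => k _.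
have km : (k <= m)%N by rewrite -ltnS.
rewrite coefZ coefXnM ltnNge km /= coef_1subX mulrCA -exprD addnBA // addnn.
by rewrite -[in RHS]signr_odd oddB ?odd_double ?signr_odd //; lia.
Qed.

(** The factor [X + 1] homogenizes to [X + (1 - X) = 1], so it raises only the nominal degree. *)
Lemma homogenize_X1M m (Q : {poly int}) : (size Q <= m.+1)%N ->
  homogenize m.+1 (Q * ('X + 1)) = homogenize m Q.
Proof.
move=> sQ; have Qm : Q`_m.+1 = 0 by apply/leq_sizeP: sQ.
rewrite /homogenize mulrDr mulr1.
under eq_bigr do rewrite coefD scalerDl.
rewrite big_split /= big_ord_recl coefMX eqxx scale0r add0r.
rewrite [X in _ + X]big_ord_recr /= Qm scale0r addr0 -big_split /=.
apply: eq_bigr => k _; have km : (k <= m)%N by rewrite -ltnS.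
rewrite coefMX /= subSS -scalerDr subSn // !exprS; congr (_ *: _); ring.
Qed.

Lemma X1E : 'X + 1 = 'X - (-1)%:P :> {poly int}.
Proof. by rewrite polyCN opprK. Qed.

Lemma homogenize_X1expM m p (Q : {poly int}) : (size Q <= m.+1)%N ->
  homogenize (m + p) (Q * ('X + 1) ^+ p) = homogenize m Q.
Proof.
move=> sQ; elim: p => [|p IH]; first by rewrite addn0 expr0 mulr1.
rewrite addnS exprSr mulrA homogenize_X1M //.
apply: (leq_trans (size_polyMleq _ _)).
by rewrite X1E size_exp_XsubC; move: sQ; lia.
Qed.

(** * The a-invariant from the multiplicity of -1 *)

Section AInvariant.
Variables (K : fieldType) (n : nat) (G : sgraph n).

Lemma hilbert_numeratorE :
  hilbert_numerator G = homogenize (indep_number G) (indep_poly G setT).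
Proof.
rewrite /hilbert_numerator /homogenize /indep_poly.
under [RHS]eq_bigr do rewrite coef_sum scaler_suml.
rewrite exchange_big /=; apply: eq_big => [A|A indA]; first by rewrite subsetT andbT.
have lt : (#|A| < (indep_number G).+1)%N by rewrite ltnS leq_bigmax_cond.
rewrite (bigD1 (Ordinal lt)) //= coefXn eqxx scale1r big1 ?addr0 // => k kA.
by rewrite coefXn -[_ == _ :> nat]/(k == Ordinal lt) (negPf kA) scale0r.
Qed.

Lemma size_indep_poly : (size (indep_poly G setT) <= (indep_number G).+1)%N.
Proof.
apply: (leq_trans (size_sum _ _ _)); apply/bigmax_leqP => A /andP[indA _].
by rewrite size_polyXn ltnS leq_bigmax_cond.
Qed.

(** Writing the dimension as [m + p], the factor [(X + 1)^p] disappears under homogenization and the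
    numerator has degree exactly [m]; the difference is [- p]. *)
Lemma a_invariant_edge_ideal p (Q : {poly int}) :
    krull_dim {ideal_quot (edge_ideal K G : idealr {mpoly K[n]})} (indep_number G) ->
    indep_poly G setT = Q * ('X + 1) ^+ p -> Q.[-1] != 0 ->
  a_invariant (edge_ideal K G) (- p%:Z).
Proof.
move=> dim FE Q1; exists (indep_number G), (hilbert_numerator G); split=> //.
  exact: hilbert_numerator_edge_ideal.
have Q0 : Q != 0 by apply: contraNneq Q1 => ->; rewrite horner0.
have mX : ('X + 1) ^+ p \is @monic int.
  by apply: monic_exp; rewrite X1E; apply: monicXsubC.
have := size_indep_poly; rewrite FE size_Mmonic //.
rewrite X1E size_exp_XsubC addnS /= => sQ.
have Qpos : (0 < size Q)%N by rewrite size_poly_gt0.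
have [m mE] : exists m, indep_number G = (m + p)%N.
  exists (indep_number G - p)%N; rewrite subnK // -ltnS.
  by apply: leq_trans sQ; rewrite -[p.+1]add1n leq_add2r.
have sQm : (size Q <= m.+1)%N by move: sQ; rewrite mE -addSn leq_add2r.
rewrite hilbert_numeratorE FE mE homogenize_X1expM // size_homogenize //=.
lia.
Qed.

End AInvariant.

(** * Krull dimension: lower bound from independent sets *)

Section KrullLower.
Variables (K : fieldType) (n : nat) (G : sgraph n).
Let I : idealr {mpoly K[n]} := edge_ideal K G.
Local Notation Q := {ideal_quot I}.

(** Restriction to an independent set kills the ideal, so it does not depend on the representative;
    this makes [restr_kernel] computable on classes. *)
Lemma restr_repr A (p : {mpoly K[n]}) :
  independent G A -> restr A (repr (\pi_Q p)) = restr A p.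
Proof.
move=> indA; apply/eqP; rewrite -subr_eq0 -(rmorphB (restr A)) /=; apply/eqP.
apply: (edge_idealP G _ _ A indA).
by rewrite -[_ \in _]/(_ \in (I : pred _)) Quotient.idealrBE reprK.
Qed.

Definition restr_kernel A (indA : independent G A) : pred Q :=
  fun q => restr A (repr q) == 0.

Lemma restr_kernelE A (indA : independent G A) (p : {mpoly K[n]}) :
  (\pi_Q p \in restr_kernel indA) = (restr A p == 0).
Proof. by rewrite unfold_in /restr_kernel restr_repr. Qed.

Lemma restr_kernel_idealr A (indA : independent G A) :
  idealr_closed (restr_kernel indA).
Proof.
split.
- by rewrite -[0](rmorph0 \pi_Q) restr_kernelE (rmorph0 (restr A)).
- by rewrite -[1](rmorph1 \pi_Q) restr_kernelE (rmorph1 (restr A)) oner_eq0.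
move=> a x y; rewrite -[a]reprK -[x]reprK -[y]reprK -rmorphM -rmorphD.
rewrite !restr_kernelE => /eqP x0 /eqP y0.
by rewrite (rmorphD (restr A)) (rmorphM (restr A)) /= x0 y0 mulr0 addr0.
Qed.

Lemma restr_kernel_prime A (indA : independent G A) :
  prime_idealr_closed (restr_kernel indA).
Proof.
move=> x y; rewrite -[x]reprK -[y]reprK -rmorphM !restr_kernelE (rmorphM (restr A)) /=.
by rewrite mulf_eq0.
Qed.

HB.instance Definition _ A (indA : independent G A) :=
  isIdealr.Build Q (restr_kernel indA) (restr_kernel_idealr indA).
HB.instance Definition _ A (indA : independent G A) :=
  isPrimeIdealrClosed.Build Q (restr_kernel indA) (@restr_kernel_prime A indA).

Lemma restr_kernelS A B (indA : independent G A) (indB : independent G B) :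
  A \proper B -> {subset restr_kernel indB <= restr_kernel indA}
    /\ ~ {subset restr_kernel indA <= restr_kernel indB}.
Proof.
move=> /properP[sAB [v vB vA]]; split=> [q|sub].
  rewrite -[q]reprK !restr_kernelE => /eqP q0.
  by rewrite -(restr_restr _ sAB) q0 rmorph0.
have := sub (\pi_Q 'X_v); rewrite !restr_kernelE !restrXU vB (negPf vA) eqxx.
move=> /(_ isT)/eqP/(congr1 (mcoeff U_(v)%MM))/eqP.
by rewrite mcoeffX eqxx mcoeff0 oner_eq0.
Qed.

(** Removing the vertices of a maximum independent set one by one strictly enlarges the kernel at
    each step. *)
Lemma exists_prime_chain :
  exists P : 'I_(indep_number G).+1 -> prime_idealr Q, prime_chain P.
Proof.
have [|A indA dE] := @eq_bigmax_cond _ (independent G) (fun A : {set _} => #|A|).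
  by apply/card_gt0P; exists set0; apply/forall_inP => i; rewrite inE.
rewrite /indep_number dE.
pose B (j : nat) := [set i in A | (j <= index i (enum A))%N].
have indB j : independent G (B j).
  by apply: independentS indA; apply/subsetP => i; rewrite inE => /andP[].
exists (fun j : 'I_#|A|.+1 => restr_kernel (indB j) : prime_idealr Q).
move=> i j ij; apply: restr_kernelS; apply/properP; split.
  apply/subsetP => k; rewrite !inE => /andP[-> /=].
  by apply: leq_trans; apply: ltnW.
have iA : (i < #|A|)%N by rewrite (leq_trans ij) // -ltnS.
exists (enum_val (Ordinal iA)); rewrite inE enum_valP /=.
  by rewrite /enum_val index_uniq ?enum_uniq // -cardE.
by rewrite /enum_val index_uniq ?enum_uniq -?cardE // -ltnNge.
Qed.

End KrullLower.

(** * Krull dimension: upper bound by counting *)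

Section KrullUpper.
Variables (K : fieldType) (n : nat) (A : comNzRingType).
Variable phi : {rmorphism {mpoly K[n]} -> A}.
Hypothesis phi_surj : forall a, exists p, phi p = a.

Lemma msizeM_leq (p q : {mpoly K[n]}) :
  (msize (p * q) <= (msize p + msize q).-1)%N.
Proof.
have [->|p0] := eqVneq p 0; first by rewrite mul0r msize0.
have [->|q0] := eqVneq q 0; first by rewrite mulr0 msize0.
by rewrite msizeM.
Qed.

Lemma msize_exp_leq (p : {mpoly K[n]}) j : (msize (p ^+ j) <= (j * msize p).+1)%N.
Proof.
elim: j => [|j IH]; first by rewrite expr0 msize1.
by rewrite exprS; apply: (leq_trans (msizeM_leq _ _)); rewrite mulSn; lia.
Qed.

(* If [f_i] lies in the [i]-th prime but not in the previous one, then products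
   of powers of the [f_i] are linearly independent modulo the bottom prime: in
   a relation, cancel the common power of [f_1] and reduce modulo the next
   prime. *)
Lemma prime_chain_independent l (P : 'I_l.+1 -> prime_idealr A) :
  prime_chain P ->
  exists D : nat, forall N : nat, exists (I : finType) (u : I -> {mpoly K[n]}),
    [/\ #|I| = (N ^ l)%N, forall i, (msize (u i) <= (N * D).+1)%N
      & forall c : I -> K, phi (\sum_i c i *: u i) \in (P ord0 : pred A) ->
          forall i, c i = 0].
Proof.
elim: l P => [|l IH] P chainP.
  exists 0%N => N; exists unit, (fun=> 1); split; first by rewrite card_unit expn0.
    by move=> _; rewrite msize1.
  move=> c; rewrite (big_pred1 tt) => [cP []|[]//].
  apply/eqP; apply: contraT => c0.
  have := idealMr (phi (c tt)^-1%:MP) cP.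
  rewrite -rmorphM mul_mpolyC scalerA mulVf // scale1r rmorph1.
  by rewrite idealr1.
have [|D HD] := IH (fun i => P (lift ord0 i)).
  by move=> i j ij; apply: chainP; rewrite !lift0.
have [|sub01 nsub10] := chainP ord0 (lift ord0 ord0); first by [].
have [a aP1 aP0] : exists2 a, a \in (P (lift ord0 ord0) : pred A) &
                              a \notin (P ord0 : pred A).
  apply: contrapT => noa; apply: nsub10 => a aP1.
  by apply: contraT => aP0; case: noa; exists a.
have [f fa] := phi_surj a; rewrite -{a}fa in aP1 aP0.
exists (D + msize f)%N => N; have [I [u [cardI szu indep_u]]] := HD N.
(* The exponent of [f] stays below [N], so adding [msize f] to [D] absorbs the extra degree. *)
exists ('I_N * I)%type, (fun ji : 'I_N * I => f ^+ ji.1 * u ji.2); split.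
- by rewrite card_prod card_ord cardI expnS.
- move=> [j i] /=; apply: (leq_trans (msizeM_leq _ _)).
  have := msize_exp_leq f j; have := szu i; have := ltn_ord j.
  move: (msize (u i)) (msize (f ^+ j)) (msize f) => x y z jN hx hy.
  have : (j * z <= N * z)%N by rewrite leq_mul2r ltnW // orbT.
  rewrite mulnDr; lia.
move=> c; pose g (j : 'I_N) := \sum_i c (j, i) *: u i.
have -> : \sum_ji c ji *: (f ^+ ji.1 * u ji.2) = \sum_(j < N) f ^+ j * g j.
  transitivity (\sum_(j < N) \sum_i c (j, i) *: (f ^+ j * u i)).
    by rewrite pair_bigA; apply: eq_bigr => -[].
  by apply: eq_bigr => j _; rewrite mulr_sumr; apply: eq_bigr => i _; rewrite scalerAr.
move=> sumP [j i]; move: j i.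
suff c0 s : (s <= N)%N -> forall j : 'I_N, (j < s)%N -> forall i, c (j, i) = 0.
  by move=> j; apply: (c0 N).
elim: s => [//|s IHs] sN j; rewrite ltnS leq_eqVlt => /predU1P[js|]; last first.
  by apply: IHs; apply: ltnW.
apply: indep_u; rewrite -/(g j).
have g0 (k : 'I_N) : (k < s)%N -> g k = 0.
  by move=> ks; apply: big1 => i _; rewrite (IHs (ltnW sN)) // scale0r.
pose r := \sum_(k : 'I_N | (s <= k)%N) f ^+ (k - s) * g k.
have rE : \sum_(k < N) f ^+ k * g k = f ^+ s * r.
  rewrite (bigID (fun k : 'I_N => (s <= k)%N)) /= addrC big1 => [|k].
    rewrite add0r mulr_sumr; apply: eq_bigr => k sk.
    by rewrite mulrA -exprD subnKC.
  by rewrite -ltnNge => ks; rewrite g0 // mulr0.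
have fsP : phi (f ^+ s) \notin (P ord0 : pred A).
  rewrite rmorphXn; elim: (s) => [|t IHt]; first by rewrite expr0 idealr1.
  by rewrite exprS prime_idealrM negb_or aP0.
have rP : phi r \in (P ord0 : pred A).
  by move: sumP; rewrite rE rmorphM prime_idealrM (negPf fsP).
have {rP} := sub01 _ rP.
(* Every other term of [r] carries a positive power of [f], which lies in the next prime; only [g j]
   remains. *)
rewrite /r (bigD1 j) ?js //= subnn expr0 mul1r rmorphD rpredDr // rmorph_sum.
apply: rpred_sum => k /andP[sk kj]; rewrite rmorphM mulrC.
have -> : (k - s)%N = (k - s).-1.+1.
  by rewrite prednK // subn_gt0 ltn_neqAle sk -js eq_sym andbT.
by rewrite exprS rmorphM mulrCA mulrC; apply: idealMr.
Qed.

(** The coefficient matrix of the restrictions has full row rank, and its columns are the exponent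
    vectors supported in [B] with entries at most [M]. *)
Lemma independent_vanish_card (B : {set 'I_n}) (I : finType)
    (u : I -> {mpoly K[n]}) (M : nat) :
  (forall i, (msize (u i) <= M.+1)%N) ->
  (forall c : I -> K, restr B (\sum_i c i *: u i) = 0 -> forall i, c i = 0) ->
  (#|I| <= M.+1 ^ #|B|)%N.
Proof.
move=> szu indep_u.
pose T : pred {ffun 'I_n -> 'I_M.+1} := pffun_on ord0 B predT.
rewrite -[X in (X ^ _)%N]card_ord -(card_pffun_on ord0) -/T.
pose mn (f : {ffun 'I_n -> 'I_M.+1}) : 'X_{1..n} := [multinom (f i : nat) | i < n].
pose Mx := \matrix_(i < #|I|, t < #|T|) (u (enum_val i))@_(mn (enum_val t)).
suff /eqP <- : row_free Mx by apply: rank_leq_col.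
apply: inj_row_free => v vM; apply/rowP => i0; rewrite mxE.
pose c i := v 0 (enum_rank i).
suff c0 : restr B (\sum_i c i *: u i) = 0.
  by have := indep_u c c0 (enum_val i0); rewrite /c enum_valK.
apply/mpolyP => m; rewrite mcoeff_restr mcoeff0; case: ifP => // /subsetP sB.
rewrite raddf_sum /=.
have [mM|mM] := leqP (mdeg m) M; last first.
  apply: big1 => i _; rewrite mcoeffZ memN_msupp_eq0 ?mulr0 //.
  apply/negP => /msize_mdeg_lt /leq_trans/(_ (szu i)).
  by rewrite ltnS leqNgt mM.
have mi i : (m i < M.+1)%N.
  by rewrite ltnS (leq_trans _ mM) // mdegE (bigD1 i) //= leq_addr.
pose f := [ffun i => inord (m i) : 'I_M.+1].
have fE i : f i = m i :> nat by rewrite ffunE inordK.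
have fT : f \in T.
  apply/pffun_onP; split=> //; apply/subsetP => i.
  by rewrite inE -val_eqE /= fE => mi0; apply: sB; rewrite inE.
have mE : mn f = m by apply/mnmP => i; rewrite mnmE fE.
have /rowP/(_ (enum_rank_in fT f)) := vM; rewrite !mxE => S0; rewrite -[RHS]S0.
rewrite (reindex (@enum_val I predT)) /=; last first.
  exact: onW_bij (@enum_val_bij I).
apply: eq_bigr => i _.
by rewrite mcoeffZ /c enum_valK mxE enum_rankK_in // mE.
Qed.

Lemma expn_growth l a D :
  (forall N, N ^ l <= (N * D).+1 ^ a)%N -> (l <= a)%N.
Proof.
move=> H; rewrite leqNgt; apply/negP => al.
(* Since [(D + 1)^a < N], this choice gives [(N (D + 1))^a < N^(a + 1)], a contradiction when
   [a < l]. *)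
pose N := (D.+1 ^ a).+1; have := H N.
have le1 : ((N * D).+1 <= N * D.+1)%N by rewrite mulnS -add1n leq_add2r.
have le2 : (N ^ a.+1 <= N ^ l)%N by rewrite leq_pexp2l.
move=> /(leq_trans le2); apply/negP; rewrite -ltnNge.
apply: (@leq_ltn_trans ((N * D.+1) ^ a)); first by case: (a) => // b; rewrite leq_exp2r.
by rewrite expnMn expnS mulnC ltn_pmul2r // expn_gt0.
Qed.

End KrullUpper.

Section Krull.
Variables (K : fieldType) (n : nat) (G : sgraph n).
Let I : idealr {mpoly K[n]} := edge_ideal K G.
Local Notation Q := {ideal_quot I}.

(** The variables outside the bottom prime form an independent set [B], since edge products vanish
    in the quotient. Every monomial not supported in [B] lies in that prime, so the independent
    products can be counted in the variables of [B]: [N^l <= (N D + 1)^#|B|] for all [N]. *)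
Lemma prime_chain_length l (P : 'I_l.+1 -> prime_idealr Q) :
  prime_chain P -> (l <= indep_number G)%N.
Proof.
move=> chainP; pose phi : {rmorphism {mpoly K[n]} -> Q} := \pi_Q.
have phi_surj a : exists p, phi p = a by exists (repr a); apply: reprK.
have [D HD] := prime_chain_independent phi_surj chainP.
pose B := [set v | phi 'X_v \notin (P ord0 : pred _)].
have indB : independent G B.
  apply/forall_inP => u; rewrite inE => uB; apply/forall_inP => v.
  rewrite inE => vB; apply/negP => Guv.
  have : phi ('X_u * 'X_v) \in (P ord0 : pred _).
    rewrite (_ : phi _ = 0) ?rpred0 //; apply/eqP.
    rewrite -(rmorph0 phi) -Quotient.idealrBE subr0.
    exact: (edge_in_ideal K Guv).
  by rewrite rmorphM prime_idealrM (negPf uB) (negPf vB).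
apply: leq_trans (leq_bigmax_cond _ indB); apply: (expn_growth (D := D)) => N.
have [J [u [<- szu indep_u]]] := HD N.
apply: (independent_vanish_card szu) => c restr0; apply: indep_u.
rewrite (mpolyE (\sum_i _)) rmorph_sum; apply: rpred_sum => m _.
rewrite -mul_mpolyC rmorphM; case: (boolP (mnm_supp m \subset B)) => mB.
  have /(congr1 (mcoeff m)) := restr0; rewrite mcoeff_restr mB mcoeff0 => ->.
  by rewrite mpolyC0 rmorph0 mul0r rpred0.
apply: idealMr; case/subsetPn: mB => v; rewrite !inE negbK => mv vP.
have le : (U_(v) <= m)%MM by rewrite lep1mP.
by rewrite -(submK le) mpolyXD rmorphM; apply: idealMr.
Qed.

Lemma krull_dim_edge_ideal : krull_dim Q (indep_number G).
Proof. by split; [apply: exists_prime_chain | apply: prime_chain_length]. Qed.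

End Krull.

(** * Splitting vertex sets at the last vertex, and the suspension *)

Section LastVertex.
Variable n : nat.
Let incl : {set 'I_n} -> {set 'I_n.+1} := fun B => lift ord_max @: B.

Lemma big_set_lastE (R : nmodType) (f : {set 'I_n.+1} -> R) :
  \sum_A f A = \sum_B f (incl B) + \sum_B f (ord_max |: incl B).
Proof.
have inclK : cancel incl (fun A : {set _} => lift ord_max @^-1: A).
  by move=> B; apply/setP => i; rewrite inE mem_imset //; apply: lift_inj.
have max_incl B : ord_max \notin incl B.
  by apply/imsetP => -[i _ /eqP]; rewrite (negPf (neq_lift _ _)).
have preimK (A : {set _}) : incl (lift ord_max @^-1: A) = A :\ ord_max.
  apply/setP => i; rewrite !inE; case: (unliftP ord_max i) => [j ->|->].
    by rewrite eq_sym neq_lift mem_imset ?inE //; apply: lift_inj.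
  by rewrite eqxx (negPf (max_incl _)).
rewrite (bigID (fun A : {set 'I_n.+1} => ord_max \notin A)) /=; congr (_ + _).
  rewrite (reindex_onto incl (fun A : {set _} => lift ord_max @^-1: A)) /=.
    by apply: eq_bigl => B; rewrite max_incl inclK eqxx.
  by move=> A mA; rewrite preimK; apply/setDidPl; rewrite disjoint_sym disjoints1.
rewrite (reindex_onto (fun B => ord_max |: incl B)
                      (fun A : {set _} => lift ord_max @^-1: A)) /=.
  apply: eq_bigl => B; rewrite setU11 /=; apply/eqP/setP => i.
  by rewrite !inE eq_sym (negPf (neq_lift _ _)) mem_imset //; apply: lift_inj.
by move=> A; rewrite negbK => mA; rewrite preimK setD1K.
Qed.

Lemma card_incl B : #|incl B| = #|B|.
Proof. by rewrite card_imset //; apply: lift_inj. Qed.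

Lemma max_notin_incl B : ord_max \notin incl B.
Proof. by apply/imsetP => -[i _ /eqP]; rewrite (negPf (neq_lift _ _)). Qed.

Lemma card_max_incl B : #|ord_max |: incl B| = #|B|.+1.
Proof. by rewrite cardsU1 max_notin_incl card_incl. Qed.

Lemma incl_subset (B : {set 'I_n}) (D : {set 'I_n.+1}) :
  (incl B \subset D) = (B \subset [set i | lift ord_max i \in D]).
Proof.
by rewrite sub_imset_pre; congr (_ \subset _); apply/setP => i; rewrite !inE.
Qed.

Lemma independent_incl (G : sgraph n.+1) (H : sgraph n) B :
    (forall i j, G (lift ord_max i) (lift ord_max j) = H i j) ->
  independent G (incl B) = independent H B.
Proof.
move=> GH; apply/forall_inP/forall_inP => ind u uB; apply/forall_inP => v vB.
  rewrite -GH; have /forall_inP := ind _ (imset_f _ uB).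
  by apply; apply: imset_f.
case/imsetP: uB => i iB ->; case/imsetP: vB => j jB ->.
by rewrite GH; have /forall_inP := ind i iB; apply.
Qed.

Lemma independent_max_incl (G : sgraph n.+1) B :
  independent G (ord_max |: incl B) =
  independent G (incl B) && [forall i in B, ~~ G ord_max (lift ord_max i)].
Proof.
apply/idP/andP => [ind|[/forall_inP ind /forall_inP maxB]].
  split; first by apply: independentS ind; apply: subsetUr.
  apply/forall_inP => i iB; have /forall_inP/(_ ord_max) := ind.
  by rewrite setU11 => /(_ isT)/forall_inP; apply; rewrite setU1r // imset_f.
apply/forall_inP => u; rewrite in_setU1 => /predU1P[->|uB].
  apply/forall_inP => v; rewrite in_setU1 => /predU1P[->|].
    by rewrite adj_irrefl.
  by case/imsetP => i iB ->; apply: maxB.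
apply/forall_inP => v; rewrite in_setU1 => /predU1P[->|vB].
  by case/imsetP: uB => i iB ->; rewrite adj_sym; apply: maxB.
by have /forall_inP := ind u uB; apply.
Qed.

End LastVertex.

(** An independent set containing the new vertex is that vertex together with an independent set of
    [G] avoiding [C]. *)
Lemma indep_poly_suspension n (G : sgraph n) (C : {set 'I_n}) :
  indep_poly (suspension G C) setT =
    indep_poly G setT + 'X * indep_poly G (~: C).
Proof.
have GH i j : suspension G C (lift ord_max i) (lift ord_max j) = G i j.
  by rewrite /= /suspension_adj !liftK.
rewrite /indep_poly big_mkcond /= big_set_lastE mulr_sumr; congr (_ + _).
  rewrite [RHS]big_mkcond; apply: eq_bigr => B _.
  by rewrite !subsetT !andbT (independent_incl _ GH) card_incl.
rewrite [RHS]big_mkcond; apply: eq_bigr => B _.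
rewrite subsetT andbT independent_max_incl (independent_incl _ GH).
rewrite card_max_incl exprS; congr (if _ && _ then _ else _).
rewrite subsetC; apply/forall_inP/subsetP => dis i => [iC|iB].
  rewrite inE; apply: contraL (iC) => iB; have := dis i iB.
  by rewrite /= /suspension_adj unlift_none liftK.
rewrite /= /suspension_adj unlift_none liftK.
by apply: contraL iB => /dis; rewrite inE.
Qed.

(** * Independence polynomials of paths with deleted vertices *)

(* Vertices avoiding the predicate [c]; indexing by [nat -> bool] lets the path
   grow at its end without changing [c]. *)
Definition path_poly (c : nat -> bool) (n : nat) : {poly int} :=
  indep_poly (path_graph n) [set i : 'I_n | ~~ c i].

Lemma path_poly0 (c : nat -> bool) : path_poly c 0 = 1.
Proof.
rewrite /path_poly /indep_poly (bigD1 set0) /=; last first.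
  by rewrite sub0set andbT; apply/forall_inP => i; rewrite inE.
rewrite cards0 expr0 big1 ?addr0 // => A /andP[_ /negP[]].
by apply/eqP/setP => -[].
Qed.

Lemma path_adj_lift n (i j : 'I_n) :
  path_graph n.+1 (lift ord_max i) (lift ord_max j) = path_graph n i j.
Proof.
have bumpE (k : 'I_n) : bump n k = k by rewrite /bump leqNgt ltn_ord.
by rewrite /= /path_adj /= !bumpE.
Qed.

Lemma indep_avoid_incl (c : nat -> bool) n (B : {set 'I_n}) :
  independent (path_graph n.+1) (lift ord_max @: B) &&
    (lift ord_max @: B \subset [set i : 'I_n.+1 | ~~ c i]) =
  independent (path_graph n) B && (B \subset [set i : 'I_n | ~~ c i]).
Proof.
rewrite (independent_incl _ (@path_adj_lift n)) incl_subset.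
rewrite (_ : [set i | _] = [set i : 'I_n | ~~ c i]) //.
by apply/setP => i; rewrite !inE lift_max.
Qed.

Lemma indep_avoid_max (c : nat -> bool) n (B : {set 'I_n}) :
  independent (path_graph n.+1) (ord_max |: lift ord_max @: B) &&
    (ord_max |: lift ord_max @: B \subset [set i : 'I_n.+1 | ~~ c i]) =
  ~~ c n && [forall i in B, i.+1 != n] &&
  (independent (path_graph n) B && (B \subset [set i : 'I_n | ~~ c i])).
Proof.
rewrite independent_max_incl subUset sub1set inE.
rewrite -(indep_avoid_incl c); set a := independent _ _; set b := _ \subset _.
rewrite (_ : [forall i in B, ~~ _] = [forall i in B, i.+1 != n]).
  by case: a; case: b; case: (c n); rewrite ?andbF ?andbT.
apply: eq_forallb => i; congr (_ ==> _).
rewrite /= /path_adj /= [bump n i]lift_max; congr (~~ _); have := ltn_ord i; lia.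
Qed.

Lemma path_poly1 (c : nat -> bool) : path_poly c 1 = 1 + (~~ c 0%N)%:R * 'X.
Proof.
have <- : path_poly c 0 + (~~ c 0%N)%:R * 'X = 1 + (~~ c 0%N)%:R * 'X.
  by rewrite path_poly0.
rewrite /path_poly /indep_poly big_mkcond big_set_lastE.
congr (_ + _).
  by rewrite [RHS]big_mkcond; apply: eq_bigr => B _; rewrite indep_avoid_incl card_incl.
rewrite (bigD1 set0) //= big1 ?addr0 => [|A /eqP[]]; last by apply/setP => -[].
rewrite indep_avoid_max card_max_incl cards0.
have -> : [forall i in set0, (i : 'I_0).+1 != 0%N].
  by apply/forall_inP => i; rewrite inE.
have -> : independent (path_graph 0) set0.
  by apply/forall_inP => i; rewrite inE.
by rewrite sub0set !andbT; case: (c _); rewrite ?mul0r ?mul1r.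
Qed.

(** An independent set containing the last vertex omits the one before it, so its remaining part is
    a set counted by [path_poly c n]. *)
Lemma path_polySS (c : nat -> bool) n :
  path_poly c n.+2 = path_poly c n.+1 + (~~ c n.+1)%:R * 'X * path_poly c n.
Proof.
rewrite /path_poly /indep_poly big_mkcond big_set_lastE; congr (_ + _).
  by rewrite [RHS]big_mkcond; apply: eq_bigr => B _; rewrite indep_avoid_incl card_incl.
rewrite big_set_lastE addrC big1 ?add0r => [|B _]; last first.
  rewrite indep_avoid_max (_ : [forall i in _, _] = false) ?andbF //.
  by apply/negbTE/forall_inPn; exists ord_max; rewrite ?setU11 //= eqxx.
rewrite [in RHS]big_mkcond mulr_sumr; apply: eq_bigr => B _.
rewrite indep_avoid_max card_max_incl indep_avoid_incl card_incl.
rewrite (_ : [forall i in _, _] = true).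
  by case: (c _) => /=; case: ifP; rewrite ?mul1r ?mul0r ?mulr0 -?exprS.
apply/forall_inP => i /imsetP[j _ ->]; rewrite lift_max.
by rewrite eqSS neq_ltn ltn_ord.
Qed.

Lemma path_poly_skip (c : nat -> bool) m :
  c m -> path_poly c m.+1 = path_poly c m.
Proof.
case: m => [|m] cm; first by rewrite path_poly1 path_poly0 cm mul0r addr0.
by rewrite path_polySS cm !mul0r addr0.
Qed.

(** * Paths minus a maximal independent set *)

Section PathMinusMaximal.
Variables (c : nat -> bool) (N : nat).
Hypothesis c_indep : forall i, c i -> ~~ c i.+1.
Hypothesis c_max : forall i, (i < N)%N -> [|| c i, c i.+1 | (0 < i)%N && c i.-1].

Let c_pred m : c m.+1 -> c m = false.
Proof. by move=> cm; apply/negbTE/negP => /c_indep; rewrite cm. Qed.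

(** With vertex [m] deleted, [m + 1] is isolated and contributes [1 + X]. *)
Let path_poly_gap1 m : c m -> ~~ c m.+1 ->
  path_poly c m.+2 = ('X + 1) * path_poly c m.+1.
Proof. by move=> cm cm1; rewrite path_polySS path_poly_skip // cm1 /=; ring. Qed.

(** With vertex [m] deleted, [m + 1] and [m + 2] form an isolated edge, whose polynomial is
    [1 + 2X]. *)
Let path_poly_gap2 m : c m -> ~~ c m.+1 -> ~~ c m.+2 ->
  path_poly c m.+3 = (1 + 2 * 'X) * path_poly c m.+1.
Proof.
move=> cm cm1 cm2; rewrite path_polySS path_poly_gap1 // cm2 /=; ring.
Qed.

(** The exceptional pattern [x_1, x_4, ...], in indices from 0 and ending exactly at [m]. *)
Let spaced m := (3 %| m)%N /\ forall i, (i <= m)%N -> c i = (3 %| i)%N.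

(* Consecutive elements of a maximal independent set are 2 or 3 apart: gaps of
   the first kind contribute the factors [X + 1], and the others [1 + 2 X]. *)
Lemma path_poly_prefix m : (m < N)%N -> c m ->
  exists p q, [/\ path_poly c m.+1 = ('X + 1) ^+ p * (1 + 2 * 'X) ^+ q,
                  p = 0%N <-> spaced m & p = 1%N -> ~~ (3 %| m)%N].
Proof.
have [k] := ubnP m; elim: k m => // k IH [|[|m]] mk mN cm.
- exists 0%N, 0%N; rewrite path_poly_skip // path_poly0 !expr0 mulr1.
  by split=> //; split=> // _; split=> // -[].
- have c0 := c_pred cm.
  exists 1%N, 0%N; rewrite path_poly_skip // path_poly1 c0 /=; split=> //.
    by rewrite expr0; ring.
  by split=> // -[].
- have c1 := c_pred cm; have [cm0|cm0] := boolP (c m).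
    have [||p [q [W p0 p1]]] := IH m _ _ cm0; [lia|lia|].
    exists p.+1, q; split.
    + by rewrite path_poly_skip // path_poly_gap1 ?c1 // W exprS; ring.
    + by split=> // -[d3 cE]; move: (cE m); rewrite cm0 => /(_ (leqW (leqnSn m))); lia.
    (* If the gap just added gives the only factor [X + 1], then [m] ends a pattern of multiples of
       three, so [m + 2] is not a multiple. *)
    by case=> /p0 [d3 _]; lia.
  (* Maximality at [m], which is two before the current vertex, forces the previous selected vertex
     to be three before it. *)
  have := c_max (ltn_trans (leqnn m.+1) (ltn_trans (leqnn m.+2) mN)).
  rewrite (negPf cm0) c1 /=; case: m => [//|m] /= in mk mN cm c1 cm0 * => cm'.
  have [||p [q [W p0 p1]]] := IH m _ _ cm'; [lia|lia|].
  exists p, q.+1; split.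
  + by rewrite path_poly_skip // path_poly_gap2 ?c1 // W exprS; ring.
  + rewrite p0; split=> -[d3 cE]; split; try lia; move=> i im.
      have [/cE//|im'] := leqP i m.
      have [->|i1] := eqVneq i m.+1; first by rewrite (negPf cm0); lia.
      have [->|i2] := eqVneq i m.+2; first by rewrite c1; lia.
      have -> : i = m.+3 by lia.
      by rewrite cm; lia.
    by apply: cE; lia.
  by move/p1; lia.
Qed.

(** After the last selected vertex at most one vertex remains, and it is isolated. The clause on
    [p = 1] keeps -1 from being a simple root when [N] is 1 modulo 3. *)
Lemma path_poly_maximal : (0 < N)%N -> ~~ c N ->
  exists p q, [/\ path_poly c N = ('X + 1) ^+ p * (1 + 2 * 'X) ^+ q,
    p = 0%N <-> (N %% 3 = 1)%N /\ forall i, (i < N)%N -> c i = (3 %| i)%N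
    & p = 1%N -> (N %% 3 <> 1)%N].
Proof.
case: N c_max path_poly_prefix => // m cm prefix _ cN.
have [c0|c0] := boolP (c m).
  have [p [q [W p0 p1]]] := prefix m (leqnn _) c0.
  exists p, q; split=> //; last by move/p1; lia.
  by rewrite p0; split=> -[d3 cE]; split=> //; lia.
have := cm m (leqnn _); rewrite (negPf c0) (negPf cN) /=.
case: m => [//|m] /= in c0 cm cN prefix * => cm0.
have [p [q [W p0 p1]]] := prefix m (leqnSn _) cm0.
exists p.+1, q; split.
- by rewrite path_poly_gap1 // W exprS; ring.
- by split=> // -[N3 cE]; have := cE m (leqnSn _); rewrite cm0; lia.
by case=> /p0[d3 _]; lia.
Qed.

End PathMinusMaximal.

(** * Order of vanishing at -1 *)

Lemma path_poly_at_N1 k (w := path_poly (fun=> false)) :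
  [/\ (w (3 * k)%N).[-1] = (-1) ^+ k, (w (3 * k).+1).[-1] = 0,
      (w (3 * k)%N)^`().[-1] = - (-1) ^+ k * k%:R
    & (w (3 * k).+1)^`().[-1] = (-1) ^+ k * k.+1%:R].
Proof.
have wS n : w n.+2 = w n.+1 + 'X * w n by rewrite /w path_polySS mul1r.
(* The values at -1 change sign every three steps; the derivatives obey the same recursion with an
   extra term [(w n).[-1]], which produces the linear growth in [k]. *)
have a n : (w n.+2).[-1] = (w n.+1).[-1] - (w n).[-1].
  by rewrite wS hornerE hornerM hornerX mulN1r.
have b n : (w n.+2)^`().[-1] = (w n.+1)^`().[-1] + (w n).[-1] - (w n)^`().[-1].
  by rewrite wS derivD derivM derivX mul1r !hornerD hornerM hornerX; ring.
elim: k => [|k [a0 a1 b0 b1]].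
  rewrite muln0 /w path_poly0 path_poly1 /= !derivE !hornerE.
  by split.
rewrite mulnS !addSn add0n !b !a a0 a1 b0 b1 !exprS -[k.+2%:R]natr1 -[k.+1%:R]natr1.
by split; ring.
Qed.

Lemma simple_root_N1 (F : {poly int}) : F.[-1] = 0 -> F^`().[-1] != 0 ->
  exists2 Q, F = Q * ('X + 1) ^+ 1 & Q.[-1] != 0.
Proof.
move=> /eqP/factor_theorem[Q ->] F1; exists Q; first by rewrite expr1 X1E.
by move: F1; rewrite derivM derivXsubC mulr1 hornerD hornerM hornerXsubC subrr mulr0 add0r.
Qed.

(** * From independence polynomials to the theorem *)

Lemma indep_poly_path n :
  indep_poly (path_graph n) setT = path_poly (fun=> false) n.
Proof. by congr (indep_poly _ _); apply/setP => i; rewrite !inE. Qed.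

Lemma indep_poly_path_setC n (C : {set 'I_n}) (c : nat -> bool) :
  (forall i : 'I_n, c i = (i \in C)) ->
  indep_poly (path_graph n) (~: C) = path_poly c n.
Proof.
by move=> cE; congr (indep_poly _ _); apply/setP => i; rewrite !inE cE.
Qed.

Lemma a_invariant_nonroot (K : fieldType) n (G : sgraph n) :
  (indep_poly G setT).[-1] != 0 -> a_invariant (edge_ideal K G) 0.
Proof.
move=> F1; rewrite -oppr0.
apply: (a_invariant_edge_ideal (p := 0) (krull_dim_edge_ideal K G) _ F1).
by rewrite expr0 mulr1.
Qed.

Lemma a_invariant_simple_root (K : fieldType) n (G : sgraph n) :
    (indep_poly G setT).[-1] = 0 -> (indep_poly G setT)^`().[-1] != 0 ->
  a_invariant (edge_ideal K G) (-1).
Proof.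
move=> F1 /(simple_root_N1 F1)[Q FE Q1].
exact: a_invariant_edge_ideal (krull_dim_edge_ideal K G) FE Q1.
Qed.

Lemma path_at_N1 n (F := indep_poly (path_graph n) setT) :
  if (n %% 3 == 1)%N then F.[-1] = 0 /\ F^`().[-1] != 0 else F.[-1] != 0.
Proof.
rewrite /F indep_poly_path; have := path_poly_at_N1 (n %/ 3).
have := divn_eq n 3; have := ltn_pmod n (isT : 0 < 3)%N.
case: (n %% 3)%N => [|[|[|//]]] _ /=; rewrite mulnC => nE [a0 a1 _ b1].
- by rewrite nE addn0 a0 signr_eq0.
- by rewrite nE addn1 a1 b1 mulf_eq0 signr_eq0 Num.Theory.pnatr_eq0.
rewrite nE addn2 path_polySS mul1r hornerD hornerM hornerX a0 a1 add0r.
by rewrite mulN1r oppr_eq0 signr_eq0.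
Qed.

(** Maximality becomes local: an unselected vertex without selected neighbours could be added to
    [C]. *)
Lemma maxset_pathP n (C : {set 'I_n}) (c : nat -> bool) :
    (forall i : 'I_n, c i = (i \in C)) -> (forall i, (n <= i)%N -> c i = false) ->
    maxset (independent (path_graph n)) C ->
  (forall i, c i -> ~~ c i.+1) /\
  (forall i, (i < n)%N -> [|| c i, c i.+1 | (0 < i)%N && c i.-1]).
Proof.
move=> cE c_out /maxsetP[indC maxC].
have lt_n i : c i -> (i < n)%N by move=> ci; rewrite ltnNge; apply: contraL ci => /c_out ->.
split=> [i ci|i i_n].
  apply/negP => ci1; have i1n := lt_n _ ci1; have i_n := lt_n _ ci.
  have /forall_inP/(_ (Ordinal i_n)) := indC; rewrite -cE => /(_ ci)/forall_inP.
  by move=> /(_ (Ordinal i1n)); rewrite -cE /= /path_adj /= eqxx => /(_ ci1).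
apply/negPn/negP; rewrite !negb_or => /and3P[/negP ci ci1 ci'].
apply: ci; pose v := Ordinal i_n; rewrite -[i]/(v : nat) cE.
suff indv : independent (path_graph n) (v |: C).
  by rewrite -(maxC _ indv (subsetUr _ _)) setU11.
have vC u : u \in C -> ~~ path_graph n v u.
  rewrite -cE /= /path_adj /= => cu; rewrite negb_or; apply/andP; split.
    by apply: contraNneq ci1 => ->.
  by apply: contra ci' => /eqP <-.
apply/forall_inP => u; rewrite in_setU1 => /predU1P[->|uC];
  apply/forall_inP => w; rewrite in_setU1 => /predU1P[->|wC].
- by rewrite adj_irrefl.
- exact: vC.
- by rewrite adj_sym; apply: vC.
- by have /forall_inP/(_ u uC)/forall_inP := indC; apply.
Qed.

Theorem theorem5p7 (K : fieldType) (n : nat) (n_ge1 : (1 <= n)%N)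
    (C : {set 'I_n}) (maxC : maxset (independent (path_graph n)) C) :
  let exceptional : Prop :=
    exists k : nat,
      n = (3 * k + 1)%N /\ C = [set i : 'I_n | (i %% 3 == 0)%N] in
  exists aR aS : int,
    [/\ a_invariant (edge_ideal K (path_graph n)) aR,
        a_invariant (edge_ideal K (suspension (path_graph n) C)) aS,
        ~ exceptional -> aS = aR
      & exceptional -> aS = (aR + 1)%R].
Proof.
move=> exceptional.
(* Beyond the path [c] is false, which supplies the boundary condition [~~ c n]. *)
pose c i := if insub i is Some j then j \in C else false.
have cE (i : 'I_n) : c i = (i \in C) by rewrite /c valK.
have c_out i : (n <= i)%N -> c i = false.
  by move=> ni; rewrite /c insubF // ltnNge ni.
have [c_indep c_max] := maxset_pathP cE c_out maxC.
have [|p [q [WE p0 p1]]] := path_poly_maximal c_indep c_max n_ge1.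
  by rewrite c_out.
have excE : exceptional <-> p = 0%N.
  rewrite p0; split=> [[k [nE CE]]|[n3 c3]].
    split=> [|i i_n]; first by lia.
    by rewrite -[i]/(Ordinal i_n : nat) cE CE inE.
  exists (n %/ 3)%N; split; first by lia.
  by apply/setP => i; rewrite inE -cE c3.
have FS := indep_poly_suspension (path_graph n) C.
rewrite (indep_poly_path_setC cE) WE in FS.
set F := indep_poly (path_graph n) setT in FS.
set W := _ * _ ^+ q in FS.
(* At -1 the factor [X + 1] is 0 and [1 + 2X] is -1, so the value is nonzero only for [p = 0]. *)
have W1 : W.[-1] = (p == 0%N)%:R * (-1) ^+ q.
  have -> : W = ('X + 1%:P) ^+ p * (1%:P + 2%:P * 'X) ^+ q.
    by rewrite /W (rmorphMn polyC) polyC1.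
  rewrite hornerM !horner_exp !hornerD hornerM hornerX !hornerC addNr expr0n.
  by rewrite (_ : 1 + 2 * -1 = -1 :> int).
have FS1 : (indep_poly (suspension (path_graph n) C) setT).[-1] = F.[-1] - W.[-1].
  by rewrite FS hornerD hornerM hornerX mulN1r.
have := path_at_N1 n; rewrite -/F; case: eqP => n3 [] => [F1 dF1|].
  (* Here -1 is a simple root of [F]. For [p = 0] the summand [X W] removes this root, and the
     a-invariant rises from -1 to 0. *)
  exists (-1); case: (posnP p) => [pE|p_gt0].
    exists 0; split; [exact: a_invariant_simple_root | | by rewrite excE | by []].
    by apply: a_invariant_nonroot; rewrite FS1 F1 W1 pE mul1r sub0r oppr_eq0 signr_eq0.
  exists (-1); split; [exact: a_invariant_simple_root | | by [] | by move/excE; lia].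
  (* As [p = 1] is excluded for [n] equal to 1 modulo 3, [X W] vanishes at -1 to order at least two
     and the root stays simple. *)
  have [r pE] : exists r, p = r.+2.
    by case: p p1 {p0 excE WE W W1 FS FS1} p_gt0 => [|[|r]] // p1; [case: (p1 erefl)|exists r].
  have WE' : W = ('X + 1) * (('X + 1) * (('X + 1) ^+ r * (1 + 2 * 'X) ^+ q)).
    by rewrite /W pE !exprS !mulrA.
  have X1 : ('X + 1 : {poly int}).[-1] = 0 by rewrite hornerD hornerX hornerC addNr.
  apply: a_invariant_simple_root.
    by rewrite FS1 F1 W1 pE mul0r subr0.
  rewrite FS derivD hornerD derivM derivX mul1r hornerD W1 pE mul0r add0r.
  rewrite [X in _ + X](_ : _ = 0) ?addr0 // WE'.
  move: ('X + 1) (_ * _ ^+ q) X1 => Y V Y1.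
  by rewrite !(derivM, hornerM, hornerD) Y1 !(mul0r, mulr0, addr0).
(* Now [n] is not 1 modulo 3, so [p] is positive and [W] vanishes at -1; neither independence
   polynomial does. *)
move=> F1; exists 0, 0.
have p_neq0 : p <> 0%N by move/p0 => [].
split; [exact: a_invariant_nonroot | | by [] | by move/excE].
by apply: a_invariant_nonroot; rewrite FS1 W1 (negPf (introN eqP p_neq0)) mul0r subr0.
Qed.
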